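(* For every positive integer $n$, $$\sum_{k=1}^n\left\{\frac{(\Psi(k+1)+\gamma)^2}{k}-\frac{\Psi(k+1)+\gamma}{k^{2}}\right\}=\frac{(\Psi(n+1)+\gamma)^3-\zeta_n(3)}{3}.$$
   Context: $\Psi(x)=\frac{d}{dx}\ln\Gamma(x)$ is the digamma function, $\gamma$ is the Euler constant, and $\zeta_n(3)=\sum_{k=1}^n k^{-3}$. *)

(* Defs.v *)
From mathcomp Require Import all_boot all_order all_algebra.
From mathcomp Require Import all_classical all_reals all_analysis.

Set Implicit Arguments.
Unset Strict Implicit.
Unset Printing Implicit Defensive.

Import Order.TTheory GRing.Theory Num.Theory.
Import numFieldNormedType.Exports.

Local Open Scope classical_set_scope.
Local Open Scope ring_scope.

(* Euler's integral; it converges, and so has its usual meaning, for 0 < x. *)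
Definition Gamma (R : realType) (x : R) : R :=
  \int[@lebesgue_measure R]_(t in `]0, +oo[) (t `^ (x - 1) * expR (- t)).

Definition digamma (R : realType) (x : R) : R :=
  derive1 (fun y : R => ln (Gamma y)) x.

Definition euler_gamma (R : realType) : R :=
  lim ((fun n : nat => \sum_(1 <= k < n.+1) (k%:R : R)^-1 - ln (n%:R : R))
         @ \oo).

(* zeta_n(s), the n-th partial sum of zeta(s). *)
Definition zeta_partial (R : realType) (n s : nat) : R :=
  \sum_(1 <= k < n.+1) ((k%:R : R) ^+ s)^-1.

(* Main.v *)
Require Import Defs.
From mathcomp Require Import all_boot all_order all_algebra.
From mathcomp Require Import all_classical all_reals all_analysis.
From mathcomp Require Import unstable measurable_realfun.
From mathcomp Require Import ring lra.

Import Order.TTheory GRing.Theory Num.Theory.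
Import numFieldNormedType.Exports.

Local Open Scope ring_scope.

(** Log-convexity and the functional equation already force
    digamma (k + 1) = H_k - gamma.  The tangent inequality
    u^h <= 1 + h (u - 1), integrated against t^(x-1) e^-t, gives Wendel's
    inequality Gamma (x + h) <= x^h Gamma x for 0 <= h <= 1; with
    Gamma (x + 1) = x Gamma x it pins every difference quotient of ln Gamma
    at M, of step |h| < 1, to within 1 / (M - 1) of ln M.  Shifting k + 1 by a
    large N adds sum_(i < N) 1 / (k + 1 + i) to the derivative, so the limit
    is H_k + lim_N (ln (k + N + 1) - H_(k + N)), and no differentiation under
    the integral sign is needed.  The sum then telescopes, because
    H^3 - (H - 1/n)^3 = 3 H^2 / n - 3 H / n^2 + 1 / n^3. *)

(** * Euler's integrand: domination, continuity and integrability *)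

Definition gamma_integrand {R : realType} (x t : R) : R :=
  t `^ (x - 1) * expR (- t).

(** Half of the decay of e^-t pays for the growth of any power of t; the other half, this function,
    remains as an integrable majorant. *)
Definition exp_half {R : realType} (t : R) : R := expR (- (t / 2)).

Local Open Scope classical_set_scope.

Section Integral.
Context {R : realType}.
Notation mu := (@lebesgue_measure R).
Implicit Types x t h : R.

Lemma gamma_integrand_ge0 x t : 0 <= gamma_integrand x t.
Proof. by rewrite mulr_ge0 ?powR_ge0 ?expR_ge0. Qed.

(** From 1 + s <= e^s at s = t / (2 x) one gets t <= 2 x e^(t / (2 x)); raising this to the power x
    gives the bound. *)
Lemma powR_le_expR_half x t : 0 < x -> 0 <= t ->
  t `^ x <= (2 * x) `^ x * expR (t / 2).
Proof.
move=> x0 t0.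
have x2 : 0 < 2 * x by rewrite mulr_gt0.
have le_base : t <= 2 * x * expR (t / (2 * x)).
  rewrite mulrC -ler_pdivrMr//.
  by apply: le_trans (expR_ge1Dx _); rewrite lerDr.
have -> : expR (t / 2) = expR (t / (2 * x)) `^ x.
  by rewrite -expRM; congr expR; field; rewrite gt_eqF.
rewrite -powRM ?expR_ge0 ?(ltW x2)//.
by rewrite ge0_ler_powR ?nnegrE ?(ltW x0)// mulr_ge0 ?expR_ge0 ?(ltW x2).
Qed.

Lemma powR_mul_expRN_le x t : 0 < x -> 0 <= t ->
  t `^ x * expR (- t) <= (2 * x) `^ x * exp_half t.
Proof.
move=> x0 t0; rewrite /exp_half.
have -> : - (t / 2) = t / 2 + - t :> R by field.
by rewrite expRD mulrA ler_wpM2r ?expR_ge0// powR_le_expR_half.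
Qed.

Lemma is_derive_exp_half t : is_derive t 1 (@exp_half R) (- (2^-1) * exp_half t).
Proof.
have := @is_derive1_comp R expR (fun t => - (t / 2)) t _ (- 2^-1)
  (is_derive_expR _).
rewrite /exp_half mulrC; apply.
rewrite (_ : (fun t => _) = - (2^-1 \*: @id R)); last first.
  by apply/funext => s; rewrite mulrC.
by apply: is_derive_eq; rewrite /GRing.scale/= mulr1.
Qed.

Lemma exp_half_cvgy : exp_half t @[t --> +oo] --> (0 : R).
Proof.
apply: (@cvg_comp _ _ _ (fun t : R => t / 2) (fun s => expR (- s)) _ +oo);
  last exact: cvgr_expR.
by apply: gt0_cvgMly => //; rewrite invr_gt0.
Qed.

Lemma continuous_exp_half : continuous (@exp_half R).
Proof.
move=> t; apply: differentiable_continuous; apply/derivable1_diffP.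
by have [] := is_derive_exp_half t.
Qed.

Lemma integral_exp_half :
  (\int[mu]_(t in `[0%R, +oo[) (exp_half t)%:E = 2%:E)%E.
Proof.
rewrite (@ge0_continuous_FTC2y R (@exp_half R) (fun t => - 2 * exp_half t) 0 0).
- by rewrite /exp_half mul0r oppr0 expR0 mulr1 -EFinB sub0r opprK.
- by move=> t _; exact: expR_ge0.
- by apply: continuous_subspaceT => t; exact: continuous_exp_half.
- rewrite -(mulr0 (- 2)); apply: cvgMr; exact: exp_half_cvgy.
- move=> t _; have [d _] := is_derive_exp_half t; exact: derivableZ.
- apply: cvgMr; apply: cvg_at_right_filter; exact: continuous_exp_half.
- move=> t _; rewrite derive1E.
  have -> : (fun t : R => - 2 * exp_half t) = (- 2) \*: (@exp_half R) by [].
  have [d e] := is_derive_exp_half t.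
  by rewrite deriveZ// e /GRing.scale/=; field.
Qed.

Lemma continuous_gamma_integrand x t : 0 < t ->
  {for t, continuous (gamma_integrand x)}.
Proof.
move=> t0; apply: differentiable_continuous; apply/derivable1_diffP.
apply: derivableM.
  by apply: derivable_powR; rewrite in_itv/= t0.
by apply: diff_derivable; apply: differentiable_comp => //; exact/derivable1_diffP.
Qed.

(** For 1 < x the factor t^(x-1) tends to 0 at 0, which is also the value of the power there, so the
    integrand is continuous up to the endpoint. Working with 1 < x is enough, since [digamma] is
    evaluated at k + 1 >= 2. *)
Lemma cvg0_gamma_integrand x : 1 < x ->
  gamma_integrand x t @[t --> 0^'+] --> gamma_integrand x 0.
Proof.
move=> x1; rewrite {2}/gamma_integrand powR0 ?subr_eq0 ?gt_eqF//.
apply: cvgM; first by apply: powR_cvg0; rewrite subr_gt0.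
apply: cvg_at_right_filter; apply: continuous_comp; first exact: opp_continuous.
exact: continuous_expR.
Qed.

Lemma within_continuous_gamma_integrand x : 1 < x ->
  {within `[0, +oo[, continuous (gamma_integrand x)}.
Proof.
move=> x1; apply/continuous_within_itvcyP; split; last exact: cvg0_gamma_integrand.
by move=> t; rewrite in_itv/= andbT => /continuous_gamma_integrand; exact.
Qed.

Lemma measurable_gamma_integrand x (D : set R) : measurable D ->
  measurable_fun D (gamma_integrand x).
Proof.
move=> mD; apply: measurable_funTS; apply: measurable_funM => //.
exact: measurableT_comp.
Qed.

Lemma integrable_exp_half : mu.-integrable `]0, +oo[ (EFin \o @exp_half R).
Proof.
have mE : measurable_fun (`]0, +oo[ : set R) (@exp_half R).
  apply: measurable_funTS; apply: continuous_measurable_fun.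
  exact: continuous_exp_half.
apply/integrableP; split; first exact/measurable_EFinP.
under eq_integral do rewrite /= ger0_norm ?expR_ge0//.
rewrite integral_itv_obnd_cbnd ?integral_exp_half ?ltry//.
exact/measurable_EFinP.
Qed.

Lemma integrable_scale c (f : R -> R) :
  mu.-integrable `]0, +oo[ (EFin \o f) ->
  mu.-integrable `]0, +oo[ (EFin \o (fun t => c * f t)).
Proof. by move=> fi; refine (integrableZl _ c fi). Qed.

Lemma integrable_add (f g : R -> R) :
  mu.-integrable `]0, +oo[ (EFin \o f) -> mu.-integrable `]0, +oo[ (EFin \o g) ->
  mu.-integrable `]0, +oo[ (EFin \o (fun t => f t + g t)).
Proof. by move=> fi gi; refine (integrableD _ fi gi). Qed.

Lemma integrable_sub (f g : R -> R) :
  mu.-integrable `]0, +oo[ (EFin \o f) -> mu.-integrable `]0, +oo[ (EFin \o g) ->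
  mu.-integrable `]0, +oo[ (EFin \o (fun t => f t - g t)).
Proof. by move=> fi gi; refine (integrableB _ fi gi). Qed.

Lemma integrable_gamma_integrand x : 1 < x ->
  mu.-integrable `]0, +oo[ (EFin \o gamma_integrand x).
Proof.
move=> x1.
have := integrable_scale ((2 * (x - 1)) `^ (x - 1)) _ integrable_exp_half.
apply: le_integrable => //.
  by apply/measurable_EFinP; exact: measurable_gamma_integrand.
move=> t /=; rewrite in_itv/= andbT => t0; rewrite lee_fin.
rewrite ger0_norm ?gamma_integrand_ge0// ger0_norm; last first.
  by rewrite mulr_ge0 ?powR_ge0 ?expR_ge0.
by rewrite powR_mul_expRN_le ?subr_gt0 ?(ltW t0).
Qed.

(** * Functional equation, Wendel's inequality and positivity of Gamma *)

Lemma GammaE x : Gamma x = \int[mu]_(t in `]0, +oo[) gamma_integrand x t.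
Proof. by []. Qed.

(* The antiderivative of x t^(x-1) e^-t - t^x e^-t vanishes at both ends; the
   multiple of exp(-t/2) only makes the integrand nonnegative, as the library's
   fundamental theorem on [0, +oo[ demands. *)
Lemma Gamma_functional x : 1 < x -> Gamma (x + 1) = x * Gamma x.
Proof.
move=> x1; have x0 : 0 < x by lra.
(* By [powR_mul_expRN_le], t^x e^-t <= K e^(-t/2): this makes [f] nonnegative and squeezes the
   boundary term to 0 at infinity. *)
pose K := (2 * x) `^ x.
have [x1' ix1'] : 1 < x + 1 /\ x + 1 - 1 = x by split; lra.
have gE t : gamma_integrand (x + 1) t = t `^ x * expR (- t).
  by rewrite /gamma_integrand ix1'.
pose f t := x * gamma_integrand x t - gamma_integrand (x + 1) t + K * exp_half t.
pose F t := gamma_integrand (x + 1) t - 2 * K * exp_half t.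
have int_f : \int[mu]_(t in `[0, +oo[) f t = 2 * K.
  rewrite (@Rintegral_ge0_continuous_FTC2y R f F 0 0).
  - rewrite /F gE powR0 ?gt_eqF// /exp_half !mul0r !oppr0 expR0; ring.
  - move=> t t0; rewrite /f -addrA addr_ge0//.
      by rewrite mulr_ge0 ?gamma_integrand_ge0 ?(ltW x0).
    by rewrite addrC subr_ge0 gE powR_mul_expRN_le.
  - have cg y : 1 < y -> forall t, `[0, +oo[ t ->
        gamma_integrand y @ within `[0, +oo[ (nbhs t) --> gamma_integrand y t.
      by move=> y1; apply/subspace_continuousP; exact: within_continuous_gamma_integrand.
    apply/subspace_continuousP => t t0; apply: cvgD; first apply: cvgB.
    + by apply: cvgMr; exact: cg.
    + exact: cg.
    + apply: cvgMr; apply: cvg_within_filter; exact: continuous_exp_half.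
  - rewrite -(subr0 0) -{2}(mulr0 (2 * K)); apply: cvgB; last first.
      apply: cvgMr; exact: exp_half_cvgy.
    have cK : K * exp_half t @[t --> +oo] --> 0.
      by rewrite -(mulr0 K); apply: cvgMr; exact: exp_half_cvgy.
    apply: (squeeze_cvgr _ (cvg_cst 0) cK).
    apply: filterS (nbhs_pinfty_ge (num_real 0)) => t t0.
    by rewrite gamma_integrand_ge0 gE powR_mul_expRN_le.
  - move=> t t0; apply: derivableB; last first.
      by have [d _] := is_derive_exp_half t; exact: derivableZ.
    apply: derivableM; first by apply: derivable_powR; rewrite in_itv/= t0.
    by apply: diff_derivable; apply: differentiable_comp => //; exact/derivable1_diffP.
  - apply: cvgB; first exact: cvg0_gamma_integrand.
    apply: cvgMr; apply: cvg_at_right_filter; exact: continuous_exp_half.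
  - move=> t; rewrite in_itv/= andbT => t0; rewrite derive1E.
    have dE : is_derive t 1 (fun t : R => expR (- t)) (expR (- t) * -1).
      by apply: (@is_derive1_comp R expR -%R).
    have dP := is_derive1_powR x t0.
    have dH := is_derive_exp_half t.
    have -> : F = ((@powR R ^~ x) * (fun t : R => expR (- t)))%R
       - (2 * K) \*: (@exp_half R).
      by apply/funext => s; rewrite /F gE.
    rewrite derive_val /f gE /gamma_integrand /GRing.scale/=; by field.
have If := integrable_gamma_integrand _ x1.
have If1 := integrable_gamma_integrand _ x1'.
have Ih := integrable_exp_half.
have Ixf : mu.-integrable `]0, +oo[ (EFin \o (fun t => x * gamma_integrand x t)).
  exact: (integrable_scale _ _ If).
have IKh : mu.-integrable `]0, +oo[ (EFin \o (fun t => K * exp_half t)).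
  exact: (integrable_scale _ _ Ih).
have IB := integrable_sub _ _ Ixf If1.
have J : \int[mu]_(t in `]0, +oo[) f t = 2 * K.
  by rewrite -int_f; apply: Rintegral_itv_obnd_cbnd; exact: integrable_add.
(* By linearity the integral of [f] is also x Gamma(x) - Gamma(x + 1) + 2 K, and 2 K cancels. *)
move: J; rewrite /f RintegralD// RintegralB// !RintegralZl// -!GammaE.
have -> : \int[mu]_(t in `]0, +oo[) exp_half t = 2.
  rewrite Rintegral_itv_obnd_cbnd//.
  by rewrite /Rintegral integral_exp_half.
lra.
Qed.

(** Convexity of exp between ln u and 0, with weights h and 1 - h. *)
Lemma powR_tangent (h u : R) : 0 <= h <= 1 -> 0 < u -> u `^ h <= 1 + h * (u - 1).
Proof.
move=> /andP[h0 h1] u0; rewrite /powR gt_eqF//.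
have := @convex_expR R (Itv01 h0 h1) (ln u) 0.
rewrite !convRE/= /onem mulr0 addr0 expR0 lnK ?posrE//.
by move=> /le_trans; apply; lra.
Qed.

Lemma Gamma_Wendel x h : 1 < x -> 0 <= h <= 1 ->
  Gamma (x + h) <= x `^ h * Gamma x.
Proof.
move=> x1 /andP[h0 h1]; have x0 : 0 < x by lra.
have xh1 : 1 < x + h by lra.
have x1' : 1 < x + 1 by lra.
have I1 := integrable_gamma_integrand _ x1.
have I2 := integrable_gamma_integrand _ x1'.
(* Chosen so that a + b t = x^h (1 + h (t / x - 1)), the tangent bound for t^h at t = x. Against
   t^(x-1) e^-t it integrates to a Gamma(x) + b Gamma(x + 1), which is x^h Gamma(x) because b x =
   x^h h. *)
pose a := x `^ h * (1 - h); pose b := x `^ h * h / x.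
have Ia : mu.-integrable `]0, +oo[ (EFin \o (fun t => a * gamma_integrand x t)).
  exact: (integrable_scale _ _ I1).
have Ib : mu.-integrable `]0, +oo[ (EFin \o (fun t => b * gamma_integrand (x + 1) t)).
  exact: (integrable_scale _ _ I2).
have -> : x `^ h * Gamma x = a * Gamma x + b * Gamma (x + 1).
  by rewrite Gamma_functional// /a /b; field; rewrite gt_eqF.
rewrite !GammaE -!RintegralZl// -RintegralD//.
apply: le_Rintegral => //.
- exact: integrable_gamma_integrand.
- exact: (integrable_add _ _ Ia Ib).
move=> t /=; rewrite in_itv/= andbT => t0.
have -> : gamma_integrand (x + h) t = t `^ h * gamma_integrand x t.
  rewrite /gamma_integrand mulrA -powRD; last by rewrite (gt_eqF t0) implybT.
  by congr (_ `^ _ * _); ring.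
have -> : gamma_integrand (x + 1) t = t * gamma_integrand x t.
  rewrite /gamma_integrand mulrA addrK mulr_powRB1//; exact: ltW.
rewrite mulrA -mulrDl ler_wpM2r ?gamma_integrand_ge0//.
have -> : t = x * (t / x) by field; rewrite gt_eqF.
rewrite powRM ?divr_ge0 ?(ltW x0) ?(ltW t0)//.
have -> : a + b * (x * (t / x)) = x `^ h * (1 + h * (t / x - 1)).
  by rewrite /a /b; field; rewrite gt_eqF.
by rewrite ler_wpM2l ?powR_ge0// powR_tangent ?divr_gt0 ?h0.
Qed.

(** On [1, 2], of length 1, the integrand is at least e^-2, since t^(x-1) >= 1 there. *)
Lemma Gamma_gt0 x : 1 < x -> 0 < Gamma x.
Proof.
move=> x1.
have sub : `[1, 2] `<=` (`]0, +oo[ : set R).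
  by move=> t /=; rewrite !in_itv/= andbT => /andP[]; lra.
have If := integrable_gamma_integrand _ x1.
apply: (@lt_le_trans _ _ (expR (- 2))); first exact: expR_gt0.
rewrite -lee_fin /Gamma /Rintegral fineK; last exact: integrable_fin_num.
have -> : ((expR (- 2))%:E = \int[mu]_(t in `[1%R, 2%R]) (expR (- 2))%:E)%E.
  pose i12 : interval R := Interval (BLeft 1) (BRight 2).
  rewrite integral_cst// [X in (_ * X)%E](lebesgue_measure_itv i12)/=.
  by rewrite lte_fin ltr1n/= -EFinB -EFinM; congr EFin; lra.
apply: (@le_trans _ _ (\int[mu]_(t in `[1%R, 2%R]) (gamma_integrand x t)%:E)%E).
  apply: ge0_le_integral => //.
  - by apply/measurable_EFinP; exact: measurable_gamma_integrand.
  - move=> t /=; rewrite in_itv/= => /andP[t1 t2]; rewrite lee_fin.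
    rewrite -[leLHS]mul1r ler_pM ?expR_ge0 ?ler_expR ?lerN2//.
    by rewrite -[leLHS](powRr0 t) ler_powR// subr_ge0 ltW.
apply: ge0_subset_integral => //.
- by apply/measurable_EFinP; exact: measurable_gamma_integrand.
- by move=> t tD; rewrite lee_fin gamma_integrand_ge0.
Qed.

End Integral.

#[local] Opaque Gamma.

(** * Increments and integer shifts of ln Gamma *)

Section LogGamma.
Context {R : realType}.
Implicit Types x h M : R.

Lemma lnGamma_functional x : 1 < x -> ln (Gamma (x + 1)) = ln x + ln (Gamma x).
Proof.
by move=> x1; rewrite Gamma_functional// lnM ?posrE ?Gamma_gt0//; lra.
Qed.

Lemma lnGamma_Wendel x h : 1 < x -> 0 <= h <= 1 ->
  ln (Gamma (x + h)) <= h * ln x + ln (Gamma x).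
Proof.
move=> x1 h01; have x0 : 0 < x by lra.
have xh1 : 1 < x + h by lra.
rewrite -ln_powR -lnM ?posrE ?powR_gt0 ?Gamma_gt0// ler_ln ?posrE ?Gamma_gt0//.
  exact: Gamma_Wendel.
by rewrite mulr_gt0 ?powR_gt0 ?Gamma_gt0.
Qed.

Lemma lnB_le (x y : R) : 0 < x -> 0 < y -> ln y - ln x <= (y - x) / x.
Proof.
move=> x0 y0; rewrite -ln_div ?posrE//.
have -> : y / x = 1 + (y - x) / x by field; rewrite gt_eqF.
apply: le_ln1Dx; rewrite mulrBl divff ?gt_eqF// ltrBrDr addrC subrr.
exact: divr_gt0.
Qed.

(** Wendel's inequality is used twice: from the smaller of M and M + h with step |h|, and from the
    larger with step 1 - |h|, which lands one above the smaller. Together they leave an error of at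
    most |ln (M + h) - ln M|. The denominator M - 1 lies below both M and M + h, hence serves both
    signs of h. *)
Lemma lnGamma_increment M h : 2 <= M -> `|h| < 1 ->
  `|ln (Gamma (M + h)) - ln (Gamma M) - h * ln M| <= `|h| / (M - 1).
Proof.
move=> M2 h1; have M0 : 0 < M by lra.
have M1 : 1 < M by lra.
have [h0|h0] := leP 0 h.
  move: h1; rewrite (ger0_norm h0) => h1.
  have Mh1 : 1 < M + h by lra.
  have Mh0 : 0 < M + h by lra.
  have leV : h / M <= h / (M - 1).
    by apply: ler_wpM2l => //; rewrite lef_pV2 ?posrE; lra.
  have h01 : 0 <= h <= 1 by lra.
  have h01' : 0 <= 1 - h <= 1 by lra.
  have MM : M <= M + h by lra.
  have up := lnGamma_Wendel M h M1 h01.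
  have := lnGamma_Wendel (M + h) (1 - h) Mh1 h01'.
  have -> : M + h + (1 - h) = M + 1 by ring.
  rewrite (lnGamma_functional _ M1).
  have := lnB_le M (M + h) M0 Mh0.
  have -> : M + h - M = h by ring.
  (* The only nonlinear fact needed: with products taken as atoms, the rest is linear. *)
  have : 0 <= h * (ln (M + h) - ln M).
    by rewrite mulr_ge0// subr_ge0 ler_ln ?posrE.
  move: up leV; move: (ln (M + h)) (ln M) (ln (Gamma _)) (ln (Gamma _)) (h / M)
    (h / (M - 1)) => l0 l g0 g q q'.
  by clear => *; rewrite ler_norml; apply/andP; split; lra.
move: h1; rewrite (ltr0_norm h0) => h1.
have Mh1 : 1 < M + h by lra.
have Mh0 : 0 < M + h by lra.
have leV : - h / (M + h) <= - h / (M - 1).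
  apply: ler_wpM2l; first by lra.
  by rewrite lef_pV2 ?posrE; lra.
have h01 : 0 <= - h <= 1 by lra.
have h01' : 0 <= 1 + h <= 1 by lra.
have MM : M + h <= M by lra.
have hN : 0 <= - h by lra.
have := lnGamma_Wendel (M + h) (- h) Mh1 h01.
have -> : M + h + - h = M by ring.
have := lnGamma_Wendel M (1 + h) M1 h01'.
have -> : M + (1 + h) = M + h + 1 by ring.
rewrite (lnGamma_functional _ Mh1).
have := lnB_le (M + h) M Mh0 M0.
have -> : M - (M + h) = - h by ring.
have : 0 <= - h * (ln M - ln (M + h)).
  by rewrite mulr_ge0// subr_ge0 ler_ln ?posrE.
move: leV; move: (ln (M + h)) (ln M) (ln (Gamma _)) (ln (Gamma _)) (- h / (M + h))
  (- h / (M - 1)) => l0 l g0 g q q'.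
by clear => *; rewrite ler_norml; apply/andP; split; lra.
Qed.

Lemma lnGamma_shift x n : 1 < x ->
  ln (Gamma (x + n%:R)) = \sum_(i < n) ln (x + i%:R) + ln (Gamma x).
Proof.
move=> x1; elim: n => [|n IH]; first by rewrite big_ord0 addr0 add0r.
have xn1 : 1 < x + n%:R by apply: (lt_le_trans x1); rewrite lerDl.
rewrite -natr1 addrA (lnGamma_functional _ xn1).
by rewrite IH big_ord_recr/= addrA [_ + ln (x + _)]addrC.
Qed.

End LogGamma.

(** * Harmonic numbers and convergence to Euler's constant *)

Section EulerConstant.
Context {R : realType}.

Definition harmonic_sum n : R := \sum_(1 <= k < n.+1) k%:R^-1.

Lemma harmonic_sumS n : harmonic_sum n.+1 = harmonic_sum n + n.+1%:R^-1.
Proof. by rewrite /harmonic_sum big_nat_recr. Qed.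

Lemma harmonic_sum_ge_ln n : ln n.+1%:R <= harmonic_sum n.
Proof.
elim: n => [|n IH]; first by rewrite ln1 /harmonic_sum big_geq.
rewrite harmonic_sumS.
have := lnB_le (n.+1%:R : R) n.+2%:R (ltr0Sn _ _) (ltr0Sn _ _).
have -> : n.+2%:R - n.+1%:R = 1 :> R by rewrite -(natr1 n.+1); ring.
by rewrite div1r => h; apply: le_trans (lerD IH h); rewrite addrC subrK.
Qed.

(** A [lim] carries information only once convergence is known; here the sequence decreases and is
    bounded below by 0. *)
Lemma euler_gamma_cvg :
  harmonic_sum n - ln (n%:R : R) @[n --> \oo] --> euler_gamma R.
Proof.
pose u n : R := harmonic_sum n - ln (n%:R : R).
suff : cvgn u by [].
(* The shift skips index 0: as [ln 0] is 0 by default, u 0 = 0 < u 1 = 1, and the sequence decreases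
   only from 1 on. *)
have : cvgn (fun n => u n.+1).
  apply: nonincreasing_is_cvgn.
    apply/nonincreasing_seqP => n; rewrite /u harmonic_sumS.
    have := lnB_le (n.+2%:R : R) n.+1%:R (ltr0Sn _ _) (ltr0Sn _ _).
    have -> : n.+1%:R - n.+2%:R = - 1 :> R by rewrite -(natr1 n.+1); ring.
    by rewrite mulN1r lerBlDl -addrA lerD2l => h; rewrite lerBlDl lerBrDl -lerBrDr.
  exists 0 => _ [n _ <-]; rewrite /u subr_ge0.
  apply: le_trans (harmonic_sum_ge_ln _).
  by rewrite ler_ln ?posrE ?ler_nat.
by move=> /cvg_ex[l]; rewrite (cvg_shiftS u) => ul; apply/cvg_ex; exists l.
Qed.

(** The form met below, where ln M comes with M = N + k + 1 and H_(N + k); it differs from the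
    previous limit by 1 / (n + 1). *)
Lemma euler_gamma_cvgS :
  harmonic_sum n - ln (n.+1%:R : R) @[n --> \oo] --> euler_gamma R.
Proof.
have cu : harmonic_sum n.+1 - ln (n.+1%:R : R) @[n --> \oo] --> euler_gamma R.
  by have := euler_gamma_cvg; rewrite -cvg_shiftS.
suff <- : (fun n => harmonic_sum n.+1 - ln (n.+1%:R : R)) - @harmonic R =
    (fun n => harmonic_sum n - ln (n.+1%:R : R)).
  by rewrite -[X in _ --> X]subr0; exact: cvgB cu cvg_harmonic.
by apply/funext => n; rewrite !fctE/= harmonic_sumS; ring.
Qed.

End EulerConstant.

(** * Digamma at positive integers, and the telescoping sum *)

Section Digamma.
Context {R : realType}.

Lemma is_derive_sum_ln (x : R) n : 0 < x ->
  is_derive x 1 (fun y => \sum_(i < n) ln (y + i%:R)) (\sum_(i < n) (x + i%:R)^-1).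
Proof.
move=> x0.
have -> : (fun y : R => \sum_(i < n) ln (y + i%:R))
    = \sum_(i < n) (fun y : R => ln (y + i%:R)).
  by apply/funext => y; rewrite fct_sumE.
apply: is_derive_sum => i.
have xi0 : 0 < x + i%:R by apply: ltr_wpDr.
rewrite -[_^-1]mulr1.
apply: (@is_derive1_comp R (@ln R) (fun y => y + i%:R)).
  exact: is_derive1_ln.
by rewrite -[X in is_derive _ _ _ X]addr0; exact: is_deriveD.
Qed.

Lemma ler_dist_third (g u d l s t e : R) :
  `|g - (u + d - l)| <= e / 3 -> `|t - l| <= e / 3 -> `|d - s| <= e / 3 ->
  `|u - g - (t - s)| <= e.
Proof.
rewrite !ler_norml => /andP[? ?] /andP[? ?] /andP[? ?].
by apply/andP; split; lra.
Qed.

Lemma slope_split (c u v p q : R) :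
  c * (p - q) = c * (u + p - (v + q)) - c * (u - v).
Proof. by ring. Qed.

(** By [lnGamma_shift], the slope of ln Gamma at a is its slope at M = a + N minus that of a sum of
    N logarithms. Three errors of e / 3 add up: the distance of H_(N + k) - ln M to Euler's
    constant, the slope at M against ln M, and the slope of the finite sum against its
    derivative. *)
Lemma digammaS k : (0 < k)%N -> digamma (k%:R + 1) = harmonic_sum k - euler_gamma R.
Proof.
move=> k0; set a : R := k%:R + 1.
have k1 : 1 <= k%:R :> R by rewrite ler1n.
rewrite /digamma /derive1; apply/cvg_lim => //.
apply/cvgrPdist_le => e e0.
have e3 : 0 < e / 3 by rewrite divr_gt0.
(* N depends on e alone and is fixed before h. The second condition controls 1 / (M - 1), as M - 1 =
   N + k. *)
have [N [gN kN]] : exists N, `|euler_gamma R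
      - (harmonic_sum (N + k)%N - ln ((N + k).+1%:R : R))| <= e / 3 /\
    ((N + k)%N%:R : R)^-1 <= e / 3.
  have [m _ Hm] := (cvgrPdist_le _ _).1 euler_gamma_cvgS _ e3.
  have [m' _ Hm'] := nbhs_infty_ger (3 / e).
  exists (m + m')%N; split; first by apply: Hm; rewrite /= -addnA leq_addr.
  rewrite invf_ple ?posrE ?ltr0n ?addn_gt0 ?k0 ?orbT// invf_div.
  by apply: Hm'; rewrite /= addnAC leq_addl.
pose M : R := a + N%:R.
have M2 : 2 <= M by rewrite /M /a; have := ler0n R N; lra.
have ME : M = (N + k).+1%:R by rewrite /M /a -natr1 natrD; ring.
have MB : M - 1 = (N + k)%N%:R by rewrite ME -natr1; ring.
have HN : harmonic_sum (N + k)%N = harmonic_sum k + \sum_(i < N) (a + i%:R)^-1 :> R.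
  elim: (N) => [|n IH]; first by rewrite big_ord0 addr0.
  rewrite addSn harmonic_sumS IH big_ord_recr/= addrA; congr (_ + _^-1).
  by rewrite /a -natr1 natrD; ring.
pose S (y : R) := \sum_(i < N) ln (y + i%:R).
have a0 : 0 < a by rewrite /a; lra.
have [dS eS] := is_derive_sum_ln a N a0.
have cS : h^-1 *: (S (h + a) - S a) @[h --> 0^'] --> \sum_(i < N) (a + i%:R)^-1.
  (* A directional derivative moves the point by h *: 1, whereas [derive1] moves it by h; the factor
     1 reconciles them. *)
  rewrite -eS; move: dS; rewrite /derivable /derive -/S => dS.
  by under eq_cvg do rewrite -[X in S (X + a)]mulr1.
have nS := (cvgrPdist_le _ _).1 cS _ e3.
near=> h.
have hn0 : h != 0 by near: h; exact: nbhs_dnbhs_neq.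
have h1 : `|h| < 1.
  near: h; exact: dnbhs0_lt.
have hS : `|\sum_(i < N) (a + i%:R)^-1 - h^-1 *: (S (h + a) - S a)| <= e / 3.
  by near: h; exact: nS.
have a1 : 1 < a by rewrite /a; lra.
have ha1 : 1 < h + a by move: h1; rewrite ltr_norml /a => /andP[]; lra.
have sa := lnGamma_shift a N a1.
have sh := lnGamma_shift (h + a) N ha1.
have Mh : h + a + N%:R = M + h by rewrite /M; ring.
rewrite Mh -/M -/(S a) -/(S (h + a)) in sa sh.
clearbody S M.
have inc : `|(S (h + a) + ln (Gamma (h + a))) - (S a + ln (Gamma a)) - h * ln M|
    <= `|h| / (N + k)%N%:R.
  by rewrite -sh -sa -MB; exact: lnGamma_increment.
have hp : 0 < `|h| by rewrite normr_gt0.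
have {}inc : `|h^-1 * (S (h + a) + ln (Gamma (h + a)) - (S a + ln (Gamma a)))
    - ln M| <= e / 3.
  rewrite -(ler_pM2l hp) -normrM mulrBr mulrA divff// mul1r.
  by apply: le_trans inc _; rewrite ler_wpM2l.
rewrite /= in hS; rewrite HN -ME in gN.
rewrite /GRing.scale/= (slope_split _ (S (h + a)) (S a)).
exact: ler_dist_third gN inc hS.
Unshelve. all: by end_near. Qed.

End Digamma.

Theorem mainTheorem4 (R : realType) (n : nat) (hn : (0 < n)%N) :
  \sum_(1 <= k < n.+1)
     ((digamma (k%:R + 1) + euler_gamma R) ^+ 2 / k%:R
      - (digamma (k%:R + 1) + euler_gamma R) / k%:R ^+ 2)
  = ((digamma (n%:R + 1) + euler_gamma R) ^+ 3 - zeta_partial R n 3) / 3.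
Proof.
rewrite digammaS// subrK.
under eq_big_nat => k /andP[k1 _] do rewrite digammaS// subrK.
(* In terms of harmonic numbers the identity also makes sense at 0, where all sums are empty, so the
   induction starts there. *)
elim: n {hn} => [|n IH].
  by rewrite /harmonic_sum /zeta_partial !big_geq// expr0n subrr mul0r.
rewrite /zeta_partial !(@big_nat_recr _ _ _ n.+1)//= IH harmonic_sumS /zeta_partial.
by field; rewrite nat1r pnatr_eq0.
Qed.
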